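(* Let $f(z)=z\ln|z|$ for $z\in\mathbb{C}$. For all $u,v\in\mathbb{C}$ (so that $|u|,|v|\ge 0$), $$ |f(u)-f(v)|\le\big(|\ln y|+1\big)\,|u-v|,\qquad y:=\max\{|u|,|v|\}. $$ Given $\alpha\in(0,1)$, denote $\delta_\alpha:=e^{\frac{\alpha}{\alpha-1}}$. If $|u|,|v|\in[0,\epsilon]$ and $0\le\epsilon\le\delta_\alpha$, then $$ |f(u)-f(v)|\le\mathcal{H}_\alpha(\epsilon)\,|u-v|^\alpha,\qquad \mathcal{H}_\alpha(\epsilon):=(2\epsilon)^{1-\alpha}\big(|\ln\epsilon|+1\big), $$ so $f(z)$ is (locally) $\alpha$-Hölder continuous.
   Context: Conventions: $f(0)=0$ (the limit of $f(z)$ as $z\to0$); $\mathcal{H}_\alpha(0)=0$ (the limit as $\epsilon\to0^+$); when $u=v=0$ the right-hand side of the first inequality is understood as $0$. ''Locally $\alpha$-Hölder continuous'' means that each point has a neighbourhood on which $|f(u)-f(v)|\le K|u-v|^\alpha$ for some constant $K$. *)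

(* Defs.v *)
From Stdlib Require Import Reals.
From Coquelicot Require Import Coquelicot.

Local Open Scope R_scope.

(* The value at [0] is [0] whatever [ln 0] is. *)
Definition zln (z : C) : C := (z * RtoC (ln (Cmod z)))%C.

(* Stdlib's [Rpower 0 a] is [1]; this is the real power [x ^ a] for [x >= 0]
   and [a > 0], with [0 ^ a = 0]. *)
Definition rpow (x a : R) : R :=
  if Rlt_dec 0 x then Rpower x a else 0.

Definition delta_of (alpha : R) : R := exp (alpha / (alpha - 1)).

(* For [alpha < 1], [Hcal alpha 0 = 0] since the first factor vanishes. *)
Definition Hcal (alpha eps : R) : R :=
  rpow (2 * eps) (1 - alpha) * (Rabs (ln eps) + 1).

Definition locally_holder (alpha : R) (g : C -> C) : Prop :=
  forall z : C, exists (U : C -> Prop) (K : R),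
    locally z U /\
    forall u v : C, U u -> U v ->
      Cmod (g u - g v)%C <= K * rpow (Cmod (u - v)%C) alpha.

(* Main.v *)
Require Import Defs.
From Stdlib Require Import Reals Lra.
From Coquelicot Require Import Coquelicot.

Local Open Scope R_scope.

(** Let [|v| <= |u| = y].  The identity
    [f u - f v = (u - v) ln |u| + v (ln |u| - ln |v|)] isolates the unbounded
    factor in a term proportional to [u - v]; the remaining term is at most
    [|u| - |v| <= |u - v|], because [ln x <= x - 1].  This is the log-Lipschitz
    bound.

    The factor [|u - v|] splits as [|u - v|^(1-alpha) |u - v|^alpha] with
    [|u - v| <= 2 y], so the log-Lipschitz bound becomes a Hölder bound with
    constant [Hcal alpha y] ([zln_holder_at_max]).  It remains to control
    [Hcal alpha y] uniformly in [y]: it increases on [[0, delta_alpha]]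
    ([Hcal_increasing]), and on a bounded interval away from [0] both of its
    factors are bounded ([Hcal_bounded]).  Hence [f] is Hölder on every bounded
    disc, and in particular locally. *)

(** * The log-Lipschitz bound *)

(** This is [ln x <= x - 1] at [x = a / b], cleared of the denominator. *)
Lemma mul_ln_diff_le (a b : R) :
  0 < b -> 0 < a -> b * (ln a - ln b) <= a - b.
Proof.
intros Hb Ha.
pose proof (exp_ineq1_le (ln a - ln b)) as H.
unfold Rminus in H; rewrite exp_plus, exp_Ropp, !exp_ln in H by assumption.
apply Rmult_le_compat_l with (r := b) in H; [|lra].
replace (b * (a * / b)) with a in H by (field; lra).
lra.
Qed.

Lemma zln_log_lipschitz_ordered (u v : C) :
  Cmod v <= Cmod u ->
  Cmod (zln u - zln v)%C <= (Rabs (ln (Cmod u)) + 1) * Cmod (u - v)%C.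
Proof.
intros Hvu.
assert (Hsplit : (zln u - zln v)%C =
  ((u - v) * RtoC (ln (Cmod u)) + v * RtoC (ln (Cmod u) - ln (Cmod v)))%C).
{ unfold zln; rewrite RtoC_minus; ring. }
rewrite Hsplit.
eapply Rle_trans; [apply Cmod_triangle|].
rewrite !Cmod_mult, !Cmod_R.
assert (Hrem : Cmod v * Rabs (ln (Cmod u) - ln (Cmod v)) <= Cmod (u - v)%C).
{ destruct (Cmod_ge_0 v) as [Hv|Hv].
  - rewrite Rabs_pos_eq by (pose proof (ln_le _ _ Hv Hvu); lra).
    pose proof (mul_ln_diff_le (Cmod u) (Cmod v) Hv ltac:(lra)).
    pose proof (Cmod_triangle (u - v)%C v) as Ht.
    replace (u - v + v)%C with u in Ht by ring.
    lra.
  - rewrite <- Hv, Rmult_0_l; apply Cmod_ge_0. }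
lra.
Qed.

Lemma Cmod_sub_sym (z w : C) : Cmod (z - w)%C = Cmod (w - z)%C.
Proof.
rewrite <- (Cmod_opp (z - w)%C); f_equal; ring.
Qed.

Lemma zln_log_lipschitz (u v : C) :
  Cmod (zln u - zln v)%C
    <= (Rabs (ln (Rmax (Cmod u) (Cmod v))) + 1) * Cmod (u - v)%C.
Proof.
destruct (Rle_dec (Cmod v) (Cmod u)) as [H|H].
- rewrite Rmax_left by assumption.
  now apply zln_log_lipschitz_ordered.
- rewrite Rmax_right by lra.
  rewrite (Cmod_sub_sym (zln u)), (Cmod_sub_sym u).
  apply zln_log_lipschitz_ordered; lra.
Qed.

(** * From log-Lipschitz to Hölder *)

Lemma rpow_nonneg (x a : R) : 0 <= rpow x a.
Proof.
unfold rpow; destruct (Rlt_dec 0 x); [|lra].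
left; apply exp_pos.
Qed.

Lemma rpow_le_compat (x y a : R) : 0 <= a -> x <= y -> rpow x a <= rpow y a.
Proof.
intros Ha Hxy; unfold rpow.
destruct (Rlt_dec 0 x) as [Hx|Hx], (Rlt_dec 0 y) as [Hy|Hy]; try lra.
- apply Rle_Rpower_l; lra.
- left; apply exp_pos.
Qed.

Lemma rpow_split (x a : R) : 0 <= x -> x = rpow x (1 - a) * rpow x a.
Proof.
intros Hx; unfold rpow; destruct (Rlt_dec 0 x) as [H|H]; [|lra].
rewrite <- Rpower_plus.
replace (1 - a + a) with 1 by ring.
now rewrite Rpower_1.
Qed.

Lemma zln_holder_at_max (alpha : R) (u v : C) : alpha < 1 ->
  Cmod (zln u - zln v)%C
    <= Hcal alpha (Rmax (Cmod u) (Cmod v)) * rpow (Cmod (u - v)%C) alpha.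
Proof.
intros Ha.
eapply Rle_trans; [apply zln_log_lipschitz|].
set (y := Rmax (Cmod u) (Cmod v)).
assert (Hd : Cmod (u - v)%C <= 2 * y).
{ pose proof (Cmod_triangle u (- v)%C) as Ht; rewrite Cmod_opp in Ht.
  pose proof (Rmax_l (Cmod u) (Cmod v)); pose proof (Rmax_r (Cmod u) (Cmod v)).
  unfold y, Cminus; lra. }
rewrite (rpow_split (Cmod (u - v)%C) alpha) at 1 by apply Cmod_ge_0.
unfold Hcal.
rewrite <- Rmult_assoc.
apply Rmult_le_compat_r; [apply rpow_nonneg|].
rewrite (Rmult_comm (rpow (2 * y) _)).
apply Rmult_le_compat_l; [pose proof (Rabs_pos (ln y)); lra|].
apply rpow_le_compat; lra.
Qed.

(** * Bounds on the Hölder constant *)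

Lemma Hcal_nonneg (alpha eps : R) : 0 <= Hcal alpha eps.
Proof.
apply Rmult_le_pos; [apply rpow_nonneg|].
pose proof (Rabs_pos (ln eps)); lra.
Qed.

Lemma ln_le_delta_of (alpha x : R) :
  0 < x <= delta_of alpha -> ln x <= alpha / (alpha - 1).
Proof.
intros [Hx Hxd].
rewrite <- (ln_exp (alpha / (alpha - 1))).
now apply ln_le.
Qed.

(** Write [c = 1 - alpha], [t = - ln y] and [s = - ln eps], so that [s <= t].
    Dividing by [(2 y)^c (1 + s)] turns the claim into
    [(1 + t) / (1 + s) <= exp (c (t - s))].  The threshold [delta_alpha] is the
    value for which [eps <= delta_alpha] says [1 <= c (1 + s)]; then
    [(1 + t) / (1 + s) = 1 + (t - s) / (1 + s) <= 1 + c (t - s)], which is at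
    most the exponential. *)
Lemma Hcal_increasing (alpha y eps : R) : 0 < alpha < 1 ->
  0 <= y <= eps -> eps <= delta_of alpha -> Hcal alpha y <= Hcal alpha eps.
Proof.
intros Ha [[Hy|Hy] Hye] Heps.
2: { subst y; unfold Hcal at 1, rpow.
     destruct (Rlt_dec 0 (2 * 0)); [lra|].
     rewrite Rmult_0_l; apply Hcal_nonneg. }
pose proof (ln_le_delta_of alpha eps ltac:(lra)) as Hs.
pose proof (ln_le y eps Hy Hye) as Hts.
assert (Hthr : alpha / (alpha - 1) = 1 - / (1 - alpha)) by (field; lra).
assert (Hinv : (1 - alpha) * / (1 - alpha) = 1) by (field; lra).
assert (Hinv1 : 1 < / (1 - alpha)).
{ rewrite <- Rinv_1; apply Rinv_lt_contravar; lra. }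
assert (Hcs : 1 <= (1 - alpha) * (1 - ln eps)).
{ apply Rle_trans with ((1 - alpha) * / (1 - alpha)); [lra|].
  apply Rmult_le_compat_l; lra. }
unfold Hcal, rpow.
destruct (Rlt_dec 0 (2 * y)); [|lra].
destruct (Rlt_dec 0 (2 * eps)); [|lra].
rewrite !Rabs_left1 by lra.
pose (d := ln eps - ln y).
assert (Hratio : Rpower (2 * eps) (1 - alpha)
  = Rpower (2 * y) (1 - alpha) * exp ((1 - alpha) * d)).
{ unfold Rpower, d; rewrite <- exp_plus, !ln_mult by lra; f_equal; ring. }
rewrite Hratio, Rmult_assoc.
apply Rmult_le_compat_l; [left; apply exp_pos|].
apply Rle_trans with ((1 + (1 - alpha) * d) * (- ln eps + 1)).
- assert (0 <= d * ((1 - alpha) * (1 - ln eps) - 1)).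
  { apply Rmult_le_pos; unfold d; lra. }
  replace (- ln y) with (d - ln eps) by (unfold d; ring).
  lra.
- apply Rmult_le_compat_r; [lra|apply exp_ineq1_le].
Qed.

(** Near [0] the logarithm is unbounded but monotonicity takes over; beyond
    [delta_alpha] the logarithm itself is bounded. *)
Lemma Hcal_bounded (alpha M : R) : 0 < alpha < 1 ->
  exists K : R, forall y : R, 0 <= y <= M -> Hcal alpha y <= K.
Proof.
intros Ha.
set (delta := delta_of alpha).
set (B := rpow (2 * M) (1 - alpha) * (Rabs (ln delta) + Rabs (ln M) + 1)).
exists (Rmax (Hcal alpha delta) B).
intros y Hy.
destruct (Rle_dec y delta) as [Hyd|Hyd].
- eapply Rle_trans; [|apply Rmax_l].
  apply Hcal_increasing; unfold delta in *; lra.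
- eapply Rle_trans; [|apply Rmax_r].
  assert (Hdelta : 0 < delta) by apply exp_pos.
  pose proof (ln_le delta y Hdelta ltac:(lra)).
  pose proof (ln_le y M ltac:(lra) ltac:(lra)).
  apply Rmult_le_compat.
  + apply rpow_nonneg.
  + pose proof (Rabs_pos (ln y)); lra.
  + apply rpow_le_compat; lra.
  + unfold Rabs; repeat destruct Rcase_abs; lra.
Qed.

Lemma zln_holder_on_disc (alpha M : R) : 0 < alpha < 1 ->
  exists K : R, forall u v : C, Cmod u <= M -> Cmod v <= M ->
    Cmod (zln u - zln v)%C <= K * rpow (Cmod (u - v)%C) alpha.
Proof.
intros Ha.
destruct (Hcal_bounded alpha M Ha) as [K HK].
exists K; intros u v Hu Hv.
eapply Rle_trans; [apply (zln_holder_at_max alpha); lra|].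
apply Rmult_le_compat_r; [apply rpow_nonneg|].
apply HK; split.
- eapply Rle_trans; [apply Cmod_ge_0|apply Rmax_l].
- now apply Rmax_lub.
Qed.

Lemma locally_Cmod_le (z : C) (M : R) :
  Cmod z < M -> locally z (fun u : C => Cmod u <= M).
Proof.
intros HM.
(* The balls of [C] are squares; the disc of radius [r] contains the square of
   half-side [r / 2]. *)
assert (Hr : 0 < (M - Cmod z) / 2) by lra.
exists (mkposreal _ Hr).
intros u [Hre Him].
change (Rabs (fst u - fst z) < (M - Cmod z) / 2) in Hre.
change (Rabs (snd u - snd z) < (M - Cmod z) / 2) in Him.
assert (Hu : u = (z + (RtoC (fst u - fst z) + Ci * RtoC (snd u - snd z)))%C).
{ destruct u as [a b], z as [c d].
  apply injective_projections; simpl; ring. }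
rewrite Hu.
eapply Rle_trans; [apply Cmod_triangle|].
pose proof (Cmod_triangle (RtoC (fst u - fst z)) (Ci * RtoC (snd u - snd z))%C)
  as Ht.
rewrite Cmod_mult, Cmod_Ci, !Cmod_R in Ht; lra.
Qed.

Theorem lemma2p1 :
  (forall u v : C,
     Cmod (zln u - zln v)%C
       <= (Rabs (ln (Rmax (Cmod u) (Cmod v))) + 1) * Cmod (u - v)%C)
  /\
  (forall alpha : R, 0 < alpha < 1 ->
     (forall (eps : R) (u v : C),
        0 <= eps <= delta_of alpha ->
        0 <= Cmod u <= eps -> 0 <= Cmod v <= eps ->
        Cmod (zln u - zln v)%C <= Hcal alpha eps * rpow (Cmod (u - v)%C) alpha)
     /\ locally_holder alpha zln).
Proof.
split; [exact zln_log_lipschitz|].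
intros alpha Ha; split.
- intros eps u v Heps Hu Hv.
  eapply Rle_trans; [apply (zln_holder_at_max alpha); lra|].
  apply Rmult_le_compat_r; [apply rpow_nonneg|].
  apply Hcal_increasing; [assumption|split|lra].
  + eapply Rle_trans; [apply Cmod_ge_0|apply Rmax_l].
  + apply Rmax_lub; lra.
- intros z.
  destruct (zln_holder_on_disc alpha (Cmod z + 1) Ha) as [K HK].
  exists (fun u : C => Cmod u <= Cmod z + 1), K; split.
  + apply locally_Cmod_le; lra.
  + exact HK.
Qed.
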